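(* For any set $\Gamma\cup\{\phi\}$ of formulas in the language of $\mathbf{PT}^+$: if $\Gamma\models\phi$ then $\Gamma\vdash\phi$ in the natural deduction system of $\mathbf{PT}^+$.
   Context: Formulas of $\mathbf{PT}^+$: $\phi::=p_i\mid\neg p_i\mid\bot\mid\mathrm{NE}\mid\phi\wedge\phi\mid\phi\otimes\phi\mid\phi\vee\phi$ ($i\in\mathbb N$). A valuation is $s:\mathbb N\to\{0,1\}$, a team a set of valuations. Semantics: $X\models p_i$ iff $s(i)=1$ for all $s\in X$; $X\models\neg p_i$ iff $s(i)=0$ for all $s\in X$; $X\models\bot$ iff $X=\emptyset$; $X\models\mathrm{NE}$ iff $X\ne\emptyset$; $\wedge$ as usual; $X\models\phi\otimes\psi$ iff $X=Y\cup Z$ for some $Y,Z\subseteq X$ with $Y\models\phi$, $Z\models\psi$; $X\models\phi\vee\psi$ iff $X\models\phi$ or $X\models\psi$. $\Gamma\models\phi$: every team satisfying all of $\Gamma$ satisfies $\phi$. Classical formulas: built from $p_i,\neg p_i,\bot$ by $\wedge,\otimes$. $p_i^1=p_i$, $p_i^0=\neg p_i$; empty $\otimes$-disjunction is $\bot$, empty $\vee$-disjunction is $\bot\wedge\mathrm{NE}$; for a team $X$ on finite $\{i_1,\dots,i_n\}$, $\Theta^*_X=\bigotimes_{s\in X}(p_{i_1}^{s(i_1)}\wedge\dots\wedge p_{i_n}^{s(i_n)}\wedge\mathrm{NE})$. Natural deduction system of $\mathbf{PT}^+$ ($\Gamma\vdash\phi$ iff some derivation of $\phi$ has undischarged assumptions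 in $\Gamma$; metavariables range over all formulas, axioms are the specific formulas shown, no substitution rule). Axioms: $p_i\otimes\neg p_i$ (each $i$); $\bot\vee\mathrm{NE}$. Rules: standard $\wedge$-introduction/elimination; $\vee$-introduction (from $\phi$ infer $\phi\vee\psi$ and $\psi\vee\phi$) and $\vee$-elimination (from $\phi\vee\psi$, a derivation of $\chi$ from $\phi$ and one from $\psi$, infer $\chi$, discharging $\phi,\psi$); from $\phi$ infer $\phi\otimes\psi$ provided $\psi$ does not contain $\mathrm{NE}$; from $\phi$ infer $\phi\otimes\phi$; from $\phi\otimes\psi$, a derivation of $\alpha$ from $\phi$ and one of $\alpha$ from $\psi$, infer $\alpha$ (discharging $\phi,\psi$), provided $\alpha$ is classical and the other undischarged assumptions of both subderivations are classical; from $\phi\otimes\psi$ and a derivation of $\chi$ from $\psi$ (discharged) infer $\phi\otimes\chi$, provided the other undischarged assumptions of that subderivation are classical; from $\phi\otimes\psi$ infer $\psi\otimes\phi$; from $\phi\otimes(\psi\otimes\chi)$ infer $(\phi\otimes\psi)\otimes\chi$; from $p_i\wedge\neg p_i$ infer $\bot$; from $\phi\otimes\bot$ infer $\phi$; from $\bot\wedge\mathrm{NE}$ infer any $\phi$; from $\phi\otimes(\bot\wedge\mathrm{NE})$ infer $\bot\wedge\mathrm{NE}$; from $\Theta^*_X\wedge\Theta^*_Y$ infer $\bot\wedge\mathrm{NE}$ whenever $X,Y$ are distinct teams on the same finite index set; from $\phi\otimes(\psi\vee\chi)$ infer $(\phi\otimes\psi)\vee(\phi\otimes\chi)$; from $\mathrm{NE}\wedge\bigotimes_{i\in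 I}\phi_i$ ($I$ finite) infer $\bigvee_{\emptyset\ne J\subseteq I}\bigotimes_{i\in J}(\mathrm{NE}\wedge\phi_i)$. *)

(* Defs.v *)
From HB Require Import structures.
From mathcomp Require Import all_boot finmap.
From mathcomp Require Import mathcomp_extra boolp classical_sets.

Set Implicit Arguments.
Unset Strict Implicit.
Unset Printing Implicit Defensive.

Local Open Scope classical_set_scope.

(* [Ten] is the team disjunction (tensor), [Or] the Boolean disjunction. *)
Inductive formula : Type :=
| Var (i : nat)
| NegVar (i : nat)
| Bot
| NE
| And (phi psi : formula)
| Ten (phi psi : formula)
| Or (phi psi : formula).

Definition valuation := nat -> bool.

Definition team := set valuation.

Fixpoint sat (X : team) (phi : formula) : Prop :=
  match phi with
  | Var i => forall s, X s -> s i = true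
  | NegVar i => forall s, X s -> s i = false
  | Bot => X = set0
  | NE => X <> set0
  | And phi psi => sat X phi /\ sat X psi
  | Ten phi psi => exists Y Z : team,
      [/\ Y `<=` X, Z `<=` X, X = Y `|` Z, sat Y phi & sat Z psi]
  | Or phi psi => sat X phi \/ sat X psi
  end.

Definition entails (Gamma : set formula) (phi : formula) : Prop :=
  forall X : team, (forall psi, Gamma psi -> sat X psi) -> sat X phi.

Fixpoint classical (phi : formula) : bool :=
  match phi with
  | Var _ | NegVar _ | Bot => true
  | And phi psi | Ten phi psi => classical phi && classical psi
  | NE | Or _ _ => false
  end.

Fixpoint NE_free (phi : formula) : bool :=
  match phi with
  | Var _ | NegVar _ | Bot => true
  | NE => false
  | And phi psi | Ten phi psi | Or phi psi => NE_free phi && NE_free psi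
  end.

Fixpoint bigTen (s : seq formula) : formula :=
  match s with
  | [::] => Bot
  | [:: phi] => phi
  | phi :: s' => Ten phi (bigTen s')
  end.

Fixpoint bigOr (s : seq formula) : formula :=
  match s with
  | [::] => And Bot NE
  | [:: phi] => phi
  | phi :: s' => Or phi (bigOr s')
  end.

Definition lit (i : nat) (b : bool) : formula := if b then Var i else NegVar i.

Definition point_formula (I : {fset nat}) (s : {ffun I -> bool}) : formula :=
  foldr And NE [seq lit (val i) (s i) | i <- enum {: I}].

(* The formula Theta^*_X of a team [X] on the finite index set [I]. *)
Definition Theta (I : {fset nat}) (X : {set {ffun I -> bool}}) : formula :=
  bigTen [seq point_formula s | s <- enum X].

Definition classical_ctx (D : set formula) : Prop :=
  forall phi, D phi -> classical phi.

(* [deriv D phi]: there is a derivation of [phi] whose set of undischarged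
   assumptions is exactly [D]; [D `\ phi] discharges [phi], which need not
   occur in [D]. *)
Inductive deriv : set formula -> formula -> Prop :=
| d_assume phi : deriv [set phi] phi
| d_ax_em i : deriv set0 (Ten (Var i) (NegVar i))
| d_ax_ne : deriv set0 (Or Bot NE)
| d_andI D1 D2 phi psi :
    deriv D1 phi -> deriv D2 psi -> deriv (D1 `|` D2) (And phi psi)
| d_andEl D phi psi : deriv D (And phi psi) -> deriv D phi
| d_andEr D phi psi : deriv D (And phi psi) -> deriv D psi
| d_orIl D phi psi : deriv D phi -> deriv D (Or phi psi)
| d_orIr D phi psi : deriv D phi -> deriv D (Or psi phi)
| d_orE D1 D2 D3 phi psi chi :
    deriv D1 (Or phi psi) -> deriv D2 chi -> deriv D3 chi ->
    deriv (D1 `|` (D2 `\ phi) `|` (D3 `\ psi)) chi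
| d_tenI D phi psi : NE_free psi -> deriv D phi -> deriv D (Ten phi psi)
| d_tenI_dup D phi : deriv D phi -> deriv D (Ten phi phi)
| d_tenE D1 D2 D3 phi psi alpha :
    classical alpha ->
    classical_ctx (D2 `\ phi) -> classical_ctx (D3 `\ psi) ->
    deriv D1 (Ten phi psi) -> deriv D2 alpha -> deriv D3 alpha ->
    deriv (D1 `|` (D2 `\ phi) `|` (D3 `\ psi)) alpha
| d_ten_sub D1 D2 phi psi chi :
    classical_ctx (D2 `\ psi) ->
    deriv D1 (Ten phi psi) -> deriv D2 chi ->
    deriv (D1 `|` (D2 `\ psi)) (Ten phi chi)
| d_ten_comm D phi psi : deriv D (Ten phi psi) -> deriv D (Ten psi phi)
| d_ten_assoc D phi psi chi :
    deriv D (Ten phi (Ten psi chi)) -> deriv D (Ten (Ten phi psi) chi)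
| d_contr D i : deriv D (And (Var i) (NegVar i)) -> deriv D Bot
| d_ten_botE D phi : deriv D (Ten phi Bot) -> deriv D phi
| d_exfalso D phi : deriv D (And Bot NE) -> deriv D phi
| d_ten_contr D phi :
    deriv D (Ten phi (And Bot NE)) -> deriv D (And Bot NE)
| d_Theta_contr D (I : {fset nat}) (X Y : {set {ffun I -> bool}}) :
    X <> Y -> deriv D (And (Theta X) (Theta Y)) -> deriv D (And Bot NE)
| d_ten_or_distr D phi psi chi :
    deriv D (Ten phi (Or psi chi)) ->
    deriv D (Or (Ten phi psi) (Ten phi chi))
| d_ne_distr D (I : finType) (F : I -> formula) :
    deriv D (And NE (bigTen [seq F i | i <- enum I])) ->
    deriv D (bigOr [seq bigTen [seq And NE (F i) | i <- enum J]
                   | J : {set I} <- enum [pred J : {set I} | J != finset.set0]]).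

Definition provable (Gamma : set formula) (phi : formula) : Prop :=
  exists D : set formula, D `<=` Gamma /\ deriv D phi.

(* Main.v *)
(** For a finite index set I, the formulas Theta^*_Z, Z ranging over the teams on
    I, are exhaustive (excluded middle and the NE-distribution rule) and mutually
    exclusive (the Theta-contradiction rule), and each of them decides every
    formula phi over I: if X has trace Z on I, then Theta^*_Z proves phi when X
    satisfies phi, and is inconsistent with phi otherwise.  If Gamma does not prove
    phi, exhaustiveness over the index sets {0, ..., n-1} gives successively teams
    V_n such that Gamma, Theta^*_(V_n) does not prove phi, and exclusiveness forces
    V_(n+1) to extend V_n.  The inverse limit X of the V_n has trace V_n on
    {0, ..., n-1}, so X satisfies Gamma and not phi. *)

Require Import Defs.
From HB Require Import structures.
From mathcomp Require Import all_boot finmap.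
From mathcomp Require Import mathcomp_extra boolp classical_sets.

Set Implicit Arguments.
Unset Strict Implicit.
Unset Printing Implicit Defensive.

Local Open Scope classical_set_scope.

(** * Derived rules for assumption sets and single connectives *)

Lemma provable_mono (Gamma Delta : set formula) phi :
  Gamma `<=` Delta -> provable Gamma phi -> provable Delta phi.
Proof. by move=> sGD [D [sD dD]]; exists D; split=> //; apply: subset_trans sGD. Qed.

Lemma provable_assume (Gamma : set formula) phi : Gamma phi -> provable Gamma phi.
Proof.
move=> Gphi; exists [set phi]; split; last exact: d_assume.
by move=> _ ->.
Qed.

Lemma provable_rule (Gamma : set formula) phi psi :
  (forall D, deriv D phi -> deriv D psi) -> provable Gamma phi -> provable Gamma psi.
Proof. by move=> rule [D [sD dD]]; exists D; split=> //; apply: rule. Qed.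

Lemma provable_andI (Gamma : set formula) phi psi :
  provable Gamma phi -> provable Gamma psi -> provable Gamma (And phi psi).
Proof.
move=> [D1 [s1 d1]] [D2 [s2 d2]]; exists (D1 `|` D2); split; last exact: d_andI.
by rewrite subUset.
Qed.

Lemma provable_andEl (Gamma : set formula) phi psi :
  provable Gamma (And phi psi) -> provable Gamma phi.
Proof. by apply: provable_rule => D; apply: d_andEl. Qed.

Lemma provable_andEr (Gamma : set formula) phi psi :
  provable Gamma (And phi psi) -> provable Gamma psi.
Proof. by apply: provable_rule => D; apply: d_andEr. Qed.

Lemma provable_orE (Gamma : set formula) phi psi chi :
  provable Gamma (Or phi psi) -> provable (phi |` Gamma) chi ->
  provable (psi |` Gamma) chi -> provable Gamma chi.
Proof.
move=> [D1 [s1 d1]] [D2 [s2 d2]] [D3 [s3 d3]].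
exists (D1 `|` (D2 `\ phi) `|` (D3 `\ psi)); split; last exact: d_orE d1 d2 d3.
move=> x [[/s1 //|[/s2 [->|//]]]|[/s3 [->|//]]]; exact: contra_notP.
Qed.

(** The language has no implication; eliminating the trivial disjunction [Or phi phi] discharges the
    assumption [phi] instead. *)
Lemma provable_cut (Gamma : set formula) phi psi :
  provable Gamma phi -> provable (phi |` Gamma) psi -> provable Gamma psi.
Proof.
move=> Gphi Gpsi; apply: (@provable_orE _ phi phi) => //.
by apply: provable_rule Gphi => D; apply: d_orIl.
Qed.

(** Only classical side assumptions may enter the subderivations, whereas [Gamma] is arbitrary;
    [Delta] is the part of [Gamma] made available there. *)
Lemma provable_tenE (Delta Gamma : set formula) phi psi alpha :
  classical_ctx Delta -> Delta `<=` Gamma -> classical alpha ->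
  provable Gamma (Ten phi psi) -> provable (phi |` Delta) alpha ->
  provable (psi |` Delta) alpha -> provable Gamma alpha.
Proof.
move=> cD sDG ca [D1 [s1 d1]] [D2 [s2 d2]] [D3 [s3 d3]].
have sub D chi : D `<=` chi |` Delta -> D `\ chi `<=` Delta.
  by move=> sD x [/sD[->|//] nx]; case: nx.
exists (D1 `|` (D2 `\ phi) `|` (D3 `\ psi)); split.
  by move=> x [[/s1 //|/(sub _ _ s2)/sDG //]|/(sub _ _ s3)/sDG].
by apply: d_tenE d1 d2 d3 => // x; [move/(sub _ _ s2)|move/(sub _ _ s3)]; apply: cD.
Qed.

Lemma provable_tenr (Delta Gamma : set formula) phi psi chi :
  classical_ctx Delta -> Delta `<=` Gamma ->
  provable Gamma (Ten phi psi) -> provable (psi |` Delta) chi ->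
  provable Gamma (Ten phi chi).
Proof.
move=> cD sDG [D1 [s1 d1]] [D2 [s2 d2]].
have sub : D2 `\ psi `<=` Delta by move=> x [/s2[->|//] nx]; case: nx.
exists (D1 `|` (D2 `\ psi)); split; first by move=> x [/s1 //|/sub/sDG].
by apply: d_ten_sub d1 d2 => x /sub; apply: cD.
Qed.

Lemma classical_NE_free phi : classical phi -> NE_free phi.
Proof. by elim: phi => //= p IHp q IHq /andP[/IHp-> /IHq->]. Qed.

Lemma classical_ctx0 : classical_ctx set0.
Proof. by []. Qed.

Lemma provable_tenC (Gamma : set formula) phi psi :
  provable Gamma (Ten phi psi) -> provable Gamma (Ten psi phi).
Proof. by apply: provable_rule => D; apply: d_ten_comm. Qed.

(** Without side assumptions the restriction to classical contexts is vacuous, and commutativity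
    lets the substitution rule act on each component in turn. *)
Lemma provable_tenS (Gamma : set formula) phi psi phi' psi' :
  provable Gamma (Ten phi psi) -> provable [set phi] phi' ->
  provable [set psi] psi' -> provable Gamma (Ten phi' psi').
Proof.
rewrite -[X in provable X phi']setU0 -[X in provable X psi']setU0 => G p1 p2.
apply: (provable_tenr classical_ctx0) p2; first exact: sub0set.
apply: provable_tenC; apply: (provable_tenr classical_ctx0) p1.
  exact: sub0set.
exact: provable_tenC.
Qed.

Lemma provable_refl phi : provable [set phi] phi.
Proof. exact: provable_assume. Qed.
#[local] Hint Resolve provable_refl : core.

(** One direction is a rule; the other is the same rule applied with the three components in reverse
    order. *)
Lemma provable_tenA (Gamma : set formula) phi psi chi :
  provable Gamma (Ten phi (Ten psi chi)) <-> provable Gamma (Ten (Ten phi psi) chi).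
Proof.
have tenA a b c : provable Gamma (Ten a (Ten b c)) -> provable Gamma (Ten (Ten a b) c).
  by apply: provable_rule => D; apply: d_ten_assoc.
split=> [|/provable_tenC h]; first exact: tenA.
have /tenA h1 : provable Gamma (Ten chi (Ten psi phi)).
  by apply: provable_tenS h _ _ => //; apply: provable_tenC.
by apply: provable_tenC; apply: provable_tenS h1 _ _ => //; apply: provable_tenC.
Qed.

Lemma provable_tenBot (Gamma : set formula) phi :
  provable Gamma (Ten phi Bot) <-> provable Gamma phi.
Proof.
split; apply: provable_rule => D; first exact: d_ten_botE.
exact: d_tenI.
Qed.

Lemma provable_botE (Gamma : set formula) phi :
  NE_free phi -> provable Gamma Bot -> provable Gamma phi.
Proof.
move=> fphi GB; apply/provable_tenBot/provable_tenC.
by apply: provable_rule GB => D; apply: d_tenI.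
Qed.

Lemma provable_contr (Gamma : set formula) phi :
  provable Gamma (And Bot NE) -> provable Gamma phi.
Proof. by apply: provable_rule => D; apply: d_exfalso. Qed.

Lemma provable_ten_contr (Gamma : set formula) phi :
  provable Gamma (Ten phi (And Bot NE)) -> provable Gamma (And Bot NE).
Proof. by apply: provable_rule => D; apply: d_ten_contr. Qed.

Lemma provable_BotorNE (Gamma : set formula) : provable Gamma (Or Bot NE).
Proof. by exists set0; split; [exact: sub0set | exact: d_ax_ne]. Qed.

(** By cases on [Or Bot NE]: [Bot] is classical, so it may be used inside the tensor, where it
    contradicts the component [NE]. *)
Lemma provable_tenNE (Gamma : set formula) phi :
  provable Gamma (Ten NE phi) -> provable Gamma NE.
Proof.
move=> GN; apply: (provable_orE (provable_BotorNE Gamma)); last first.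
  by apply: provable_assume; left.
apply: provable_contr; apply: (@provable_ten_contr _ phi).
apply: (@provable_tenr [set Bot] _ phi NE).
- by move=> _ ->.
- exact: subsetUl.
- by apply: provable_mono (provable_tenC GN); apply: subsetUr.
- by apply: provable_andI; apply: provable_assume; [right | left].
Qed.

(** * Iterated tensors and Boolean disjunctions *)

(** A one-element [bigTen] is the formula itself, without a final [Bot], so this unfolding holds
    only up to provability. *)
Lemma provable_bigTen_cons (Gamma : set formula) phi s :
  provable Gamma (bigTen (phi :: s)) <-> provable Gamma (Ten phi (bigTen s)).
Proof. by case: s => [|psi s] //=; split=> /provable_tenBot. Qed.

Lemma provable_bigTen_cat (Gamma : set formula) s t :
  provable Gamma (bigTen (s ++ t)) <-> provable Gamma (Ten (bigTen s) (bigTen t)).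
Proof.
elim: s Gamma => [|phi s IHs] Gamma.
  rewrite cat0s; split=> [h|/provable_tenC/provable_tenBot //].
  exact/provable_tenC/provable_tenBot.
rewrite cat_cons; split=> [/provable_bigTen_cons h|h].
  have /provable_tenA h1 : provable Gamma (Ten phi (Ten (bigTen s) (bigTen t))).
    by apply: provable_tenS h _ _ => //; apply/IHs.
  by apply: provable_tenS h1 _ _ => //; apply/provable_bigTen_cons.
apply/provable_bigTen_cons.
have /provable_tenA h1 : provable Gamma (Ten (Ten phi (bigTen s)) (bigTen t)).
  by apply: provable_tenS h _ _ => //; apply/provable_bigTen_cons.
by apply: provable_tenS h1 _ _ => //; apply/IHs.
Qed.

Lemma provable_bigTen_map (T : eqType) (F G : T -> formula) s Gamma :
  {in s, forall x, provable [set F x] (G x)} ->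
  provable Gamma (bigTen (map F s)) -> provable Gamma (bigTen (map G s)).
Proof.
elim: s Gamma => [//|x s IHs] Gamma FG /provable_bigTen_cons h.
apply/provable_bigTen_cons; apply: provable_tenS h _ _.
  by apply: FG; rewrite mem_head.
by apply: IHs => // y ys; apply: FG; rewrite inE ys orbT.
Qed.

Section Idempotent.
Variables (T : eqType) (F : T -> formula).
Hypothesis F_idem : forall x, provable [set Ten (F x) (F x)] (F x).

(** In general [Ten phi phi] does not entail [phi] (take [Or (Var 0) (NegVar 0)]), whence [F_idem];
    the converse is the duplication rule. *)
Lemma provable_bigTen_head x s Gamma : x \in s ->
  provable Gamma (bigTen (map F (x :: s))) <-> provable Gamma (bigTen (map F s)).
Proof.
elim: s Gamma => [//|y s IHs] Gamma; rewrite inE => /predU1P[<-|/IHs{}IHs].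
  split=> [/provable_bigTen_cons h|/provable_bigTen_cons h].
    have /provable_tenA h1 : provable Gamma (Ten (F x) (Ten (F x) (bigTen (map F s)))).
      by apply: provable_tenS h _ _ => //; apply/provable_bigTen_cons.
    by apply/provable_bigTen_cons; apply: provable_tenS h1 _ _.
  apply/provable_bigTen_cons.
  have /provable_tenA h1 : provable Gamma (Ten (Ten (F x) (F x)) (bigTen (map F s))).
    apply: provable_tenS h _ _ => //.
    by apply: provable_rule (provable_refl _) => D; apply: d_tenI_dup.
  by apply: provable_tenS h1 _ _ => //; apply/provable_bigTen_cons.
have swap a b c D : provable D (Ten a (Ten b c)) -> provable D (Ten b (Ten a c)).
  move=> /provable_tenA h; apply/provable_tenA; apply: provable_tenS h _ _ => //.
  exact: provable_tenC.
split=> [/provable_bigTen_cons h|/provable_bigTen_cons h].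
  apply/provable_bigTen_cons.
  have /swap h1 : provable Gamma (Ten (F x) (Ten (F y) (bigTen (map F s)))).
    by apply: provable_tenS h _ _ => //; apply/provable_bigTen_cons.
  by apply: provable_tenS h1 _ _ => //; apply/IHs/provable_bigTen_cons.
apply/provable_bigTen_cons.
have /swap h1 : provable Gamma (Ten (F y) (Ten (F x) (bigTen (map F s)))).
  by apply: provable_tenS h _ _ => //; apply/provable_bigTen_cons/IHs.
by apply: provable_tenS h1 _ _ => //; apply/provable_bigTen_cons.
Qed.

Lemma provable_bigTen_absorb s t Gamma : {subset t <= s} ->
  provable Gamma (bigTen (map F (t ++ s))) <-> provable Gamma (bigTen (map F s)).
Proof.
elim: t => [//|x t IHt] sts; rewrite cat_cons provable_bigTen_head.
  by apply: IHt => y yt; apply: sts; rewrite inE yt orbT.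
by rewrite mem_cat sts ?orbT // mem_head.
Qed.

(** Both tensors are equivalent to the one over the concatenated lists, so neither order nor
    multiplicity matters. *)
Lemma provable_bigTen_eq_mem s t Gamma : s =i t ->
  provable Gamma (bigTen (map F s)) -> provable Gamma (bigTen (map F t)).
Proof.
move=> st h; have sub1 : {subset s <= t} by move=> x; rewrite st.
have sub2 : {subset t <= s} by move=> x; rewrite st.
apply/(provable_bigTen_absorb Gamma sub1); rewrite map_cat.
apply/provable_bigTen_cat/provable_tenC/provable_bigTen_cat; rewrite -map_cat.
exact/(provable_bigTen_absorb Gamma sub2).
Qed.

End Idempotent.

(** A contradictory component makes every tensor around it contradictory. *)
Lemma provable_bigTen_contr (T : eqType) (F : T -> formula) x s
    (Delta Gamma : set formula) :
  classical_ctx Delta -> Delta `<=` Gamma -> x \in s ->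
  provable Gamma (bigTen (map F s)) -> provable (F x |` Delta) (And Bot NE) ->
  provable Gamma (And Bot NE).
Proof.
move=> cD; elim: s Gamma => [//|y s IHs] Gamma sDG xs /provable_bigTen_cons h hx.
case/predU1P: xs => [xy|xs].
  rewrite -xy in h; apply: provable_ten_contr; apply: (provable_tenr cD sDG _ hx).
  exact: provable_tenC h.
apply: (@provable_ten_contr _ (F y)); apply: (provable_tenr cD sDG h).
apply: (IHs _ (@subsetUr _ _ _) xs _ hx).
by apply: provable_assume; left.
Qed.

(** Iterated tensor elimination; the empty tensor [Bot] yields [alpha] because classical formulas
    are free of [NE]. *)
Lemma provable_bigTenE (T : eqType) (F : T -> formula) s Gamma alpha :
  classical alpha -> {in s, forall x, provable [set F x] alpha} ->
  provable Gamma (bigTen (map F s)) -> provable Gamma alpha.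
Proof.
move=> ca; have fa := classical_NE_free ca.
elim: s Gamma => [|x s IHs] Gamma Fa; first exact: provable_botE.
move=> /provable_bigTen_cons h.
apply: (provable_tenE classical_ctx0 (@sub0set _ _) ca h); rewrite setU0.
  by apply: Fa; rewrite mem_head.
by apply: IHs => // y ys; apply: Fa; rewrite inE ys orbT.
Qed.

Lemma provable_bigOrE (T : eqType) (F : T -> formula) s Gamma chi :
  provable Gamma (bigOr (map F s)) ->
  {in s, forall x, provable (F x |` Gamma) chi} -> provable Gamma chi.
Proof.
elim: s Gamma => [|x [|y s] IHs] Gamma.
- by move=> h _; apply: provable_contr.
- by move=> /= h hx; apply: provable_cut h _; apply: hx; rewrite mem_head.
move=> h hx; apply: (provable_orE h); first by apply: hx; rewrite mem_head.
apply: IHs => [|z zs]; first by apply: provable_assume; left.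
apply: provable_mono (hx z _); last by rewrite inE zs orbT.
by move=> u [->|?]; [left | right; right].
Qed.

(** Distributivity moves the disjunction out of the tensor, so that the cases are treated outside
    it, where all of [Gamma] is available. *)
Lemma provable_ten_bigOrE (T : eqType) (F : T -> formula) s Gamma phi chi :
  provable Gamma (Ten phi (bigOr (map F s))) ->
  {in s, forall x, provable (Ten phi (F x) |` Gamma) chi} -> provable Gamma chi.
Proof.
elim: s Gamma => [|x [|y s] IHs] Gamma.
- by move=> h _; apply/provable_contr/provable_ten_contr/h.
- by move=> /= h hx; apply: provable_cut h _; apply: hx; rewrite mem_head.
move=> h hx.
have {}h : provable Gamma (Or (Ten phi (F x)) (Ten phi (bigOr (map F (y :: s))))).
  by apply: provable_rule h => D; apply: d_ten_or_distr.
apply: (provable_orE h); first by apply: hx; rewrite mem_head.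
apply: IHs => [|z zs]; first by apply: provable_assume; left.
apply: provable_mono (hx z _); last by rewrite inE zs orbT.
by move=> u [->|?]; [left | right; right].
Qed.

Lemma provable_bigOrI (T : eqType) (F : T -> formula) s x Gamma :
  x \in s -> provable Gamma (F x) -> provable Gamma (bigOr (map F s)).
Proof.
move=> + h; elim: s => [//|y [|z s] IHs]; first by rewrite inE => /eqP <-.
rewrite inE => /predU1P[<-|/IHs].
  by apply: provable_rule h => D; apply: d_orIl.
by apply: provable_rule => D; apply: d_orIr.
Qed.

Lemma provable_bigTenI (T : eqType) (F : T -> formula) s x Gamma :
  {in s, forall y, NE_free (F y)} -> x \in s ->
  provable Gamma (F x) -> provable Gamma (bigTen (map F s)).
Proof.
move=> + + h; elim: s => [//|y s IHs] Fs xs; apply/provable_bigTen_cons.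
have {}IHs : x \in s -> provable Gamma (bigTen (map F s)).
  by apply: IHs => z zs; apply: Fs; rewrite inE zs orbT.
have [x_s|nx_s] := boolP (x \in s).
  apply: provable_tenC; apply: provable_rule (IHs x_s) => D; apply: d_tenI.
  by apply: Fs; rewrite mem_head.
move: xs Fs; rewrite inE (negPf nx_s) orbF => /eqP <- Fs.
apply: provable_rule h => D; apply: d_tenI.
have {nx_s IHs} : {in s, forall y, NE_free (F y)}.
  by move=> z zs; apply: Fs; rewrite inE zs orbT.
elim: s {Fs} => [//|z [|w s] IHs] Fs /=; first by apply: Fs; rewrite mem_head.
apply/andP; split; first by apply: Fs; rewrite mem_head.
by apply: IHs => u us; apply: Fs; rewrite inE us orbT.
Qed.

Lemma provable_foldAndI (T : eqType) (F : T -> formula) b s Gamma :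
  provable Gamma b -> {in s, forall x, provable Gamma (F x)} ->
  provable Gamma (foldr And b (map F s)).
Proof.
move=> hb; elim: s => [//|x s IHs] Fs /=; apply: provable_andI.
  by apply: Fs; rewrite mem_head.
by apply: IHs => y ys; apply: Fs; rewrite inE ys orbT.
Qed.

Lemma provable_foldAndE (T : eqType) (F : T -> formula) b s x Gamma :
  x \in s -> provable Gamma (foldr And b (map F s)) -> provable Gamma (F x).
Proof.
move=> + h; elim: s h => [//|y s IHs] /= h; rewrite inE => /predU1P[->|xs].
  exact: provable_andEl h.
exact: IHs (provable_andEr h) xs.
Qed.

Lemma provable_foldAnd_last b s Gamma :
  provable Gamma (foldr And b s) -> provable Gamma b.
Proof. by elim: s => [//|y s IHs] /= /provable_andEr. Qed.

(** * Literals, points, and exhaustiveness of the formulas [Theta] *)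

Lemma classical_lit i b : classical (lit i b).
Proof. by case: b. Qed.

Lemma provable_lit_contr (Gamma : set formula) i b :
  provable Gamma (lit i b) -> provable Gamma (lit i (~~ b)) -> provable Gamma Bot.
Proof.
move=> hb hnb; apply: (@provable_rule _ (And (Var i) (NegVar i))) => [D|].
  exact: d_contr.
by case: b hb hnb => /= h1 h2; apply: provable_andI.
Qed.

Section IndexSet.
Variable I : {fset nat}.
Implicit Types (f g : {ffun I -> bool}) (X Y : team).

Lemma provable_point_lit f i Gamma :
  provable Gamma (point_formula f) -> provable Gamma (lit (val i) (f i)).
Proof.
by apply: (@provable_foldAndE _ (fun i => lit (val i) (f i))); rewrite mem_enum.
Qed.

Lemma provable_point_NE f Gamma :
  provable Gamma (point_formula f) -> provable Gamma NE.
Proof. exact: provable_foldAnd_last. Qed.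

Lemma provable_pointI f Gamma :
  provable Gamma NE -> (forall i : I, provable Gamma (lit (val i) (f i))) ->
  provable Gamma (point_formula f).
Proof. by move=> hNE hf; apply: provable_foldAndI. Qed.

(** Point formulas contain [NE], so tensor elimination cannot produce them at once; it yields the
    classical literals one by one, and [NE] is recovered separately. *)
Lemma provable_point_idem f :
  provable [set Ten (point_formula f) (point_formula f)] (point_formula f).
Proof.
apply: provable_pointI => [|i].
  apply: (@provable_tenNE _ (point_formula f)).
  by apply: provable_tenS (provable_refl _) _ _ => //; apply: provable_point_NE.
apply: (provable_tenE classical_ctx0 (@sub0set _ _) (classical_lit _ _) (provable_refl _)).
  by rewrite setU0; apply: provable_point_lit.
by rewrite setU0; apply: provable_point_lit.
Qed.

(* [Ten (Var 0) (NegVar 0)] stands in for a classical truth constant, which the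
   language lacks. *)
Definition classical_point f : formula :=
  foldr And (Ten (Var 0) (NegVar 0)) [seq lit (val i) (f i) | i <- enum {: I}].

Lemma classical_pointP f : classical (classical_point f).
Proof.
by rewrite /classical_point; elim: (enum _) => [//|i s IHs] /=; rewrite classical_lit.
Qed.

Lemma provable_em (Gamma : set formula) i : provable Gamma (Ten (Var i) (NegVar i)).
Proof. by exists set0; split; [exact: sub0set | exact: d_ax_em]. Qed.

(** The disjunctive normal form of a classical tautology: variables are decided one at a time by
    eliminating [Ten (Var i) (NegVar i)], which is allowed since the goal and the literals already
    assumed are classical. *)
Lemma provable_classical_points (Gamma : set formula) :
  provable Gamma (bigTen [seq classical_point f | f <- enum {: {ffun I -> bool}}]).
Proof.
set T := bigTen _.
have cT : classical T.
  rewrite /T; elim: (enum _) => [//|f [|f' s] IHs] /=; first exact: classical_pointP.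
  by rewrite classical_pointP.
(* [s] lists the variables still undecided; [Delta s g] assumes the values of [g] at all others. *)
pose Delta (s : seq I) g := [set lit (val i) (g i) | i in [set i | i \notin s]].
have step s : forall g, provable (Delta s g) T.
  elim: s => [|i s IHs] g.
    apply: (@provable_bigTenI _ _ _ g) => [f _||]; rewrite ?mem_enum //.
      exact/classical_NE_free/classical_pointP.
    apply: provable_foldAndI => [|i _]; first exact: provable_em.
    by apply: provable_assume; exists i.
  pose g' b : {ffun I -> bool} := [ffun j => if j == i then b else g j].
  have sub b : Delta s (g' b) `<=` lit (val i) b |` Delta (i :: s) g.
    move=> _ [j /= js <-]; rewrite ffunE; case: eqP => [->|/eqP ji]; first by left.
    by right; exists j => //=; rewrite inE negb_or ji.
  have cD : classical_ctx (Delta (i :: s) g) by move=> _ [j _ <-]; apply: classical_lit.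
  apply: (provable_tenE cD _ cT (provable_em _ (val i))) => //.
    exact: provable_mono (sub true) (IHs _).
  exact: provable_mono (sub false) (IHs _).
(* With every variable undecided [Delta] is empty, so the assignment chosen is immaterial. *)
apply: provable_mono (step (enum {: I}) [ffun=> true]).
by move=> phi [i /=]; rewrite mem_enum.
Qed.

(** If the team is empty, [Theta] of the empty set, which is [Bot], holds. Otherwise the
    [NE]-distribution rule, applied to the tensor of all classical points, selects the set of points
    that occur. *)
Lemma provable_bigOr_Theta (Gamma : set formula) :
  provable Gamma (bigOr [seq Theta Z | Z <- enum {: {set {ffun I -> bool}}}]).
Proof.
apply: (provable_orE (provable_BotorNE Gamma)).
  apply: (@provable_bigOrI _ _ _ finset.set0); first by rewrite mem_enum.
  by rewrite /Theta enum_set0; apply: provable_assume; left.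
set G := _ |` _.
have h : provable G (And NE (bigTen [seq classical_point f | f <- enum {: {ffun I -> bool}}])).
  by apply: provable_andI (provable_classical_points G); apply: provable_assume; left.
have := provable_rule (fun D => @d_ne_distr D _ _) h.
move=> /provable_bigOrE; apply=> J _.
apply: (@provable_bigOrI _ _ _ J); first by rewrite mem_enum.
apply: provable_bigTen_map (provable_assume _); last by left.
move=> f _; apply: provable_pointI => [|i]; first exact: provable_andEl.
have := provable_andEr (provable_refl (And NE (classical_point f))).
by apply: (@provable_foldAndE _ (fun i => lit (val i) (f i))); rewrite mem_enum.
Qed.

(** * Traces of teams on the index set and their diagrams *)

Definition restr (s : valuation) : {ffun I -> bool} := [ffun i => s (val i)].

(** The value [false] outside [I] is arbitrary. *)
Definition extend f : valuation := fun i => if insub i is Some j then f j else false.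

Lemma extendK f : restr (extend f) = f.
Proof. by apply/ffunP => i; rewrite ffunE /extend valK. Qed.

Definition trace X : {set {ffun I -> bool}} :=
  finset (fun f => `[< exists2 s, X s & restr s = f >]).

Lemma mem_trace X f : reflect (exists2 s, X s & restr s = f) (f \in trace X).
Proof. by rewrite inE; apply: asboolP. Qed.

Lemma trace_surj (Z : {set {ffun I -> bool}}) : exists X, trace X = Z.
Proof.
exists [set s | restr s \in Z]; apply/setP => f; apply/mem_trace/idP.
  by move=> [s /= ? <-].
by move=> fZ; exists (extend f); rewrite /= extendK.
Qed.

Lemma traceU X Y : trace (X `|` Y) = (trace X :|: trace Y)%SET.
Proof.
apply/setP => f; rewrite finset.in_setU; apply/mem_trace/orP.
  by move=> [s [Xs|Ys] <-]; [left|right]; apply/mem_trace; exists s.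
by move=> [/mem_trace[s Xs <-]|/mem_trace[s Ys <-]]; exists s => //; [left|right].
Qed.

(** It depends on [X] only through its trace, but taking a team as argument allows a direct
    comparison with [sat]. *)
Definition diagram X : formula := Theta (trace X).

Lemma provable_diagram_cases (Gamma : set formula) chi :
  (forall X, provable (diagram X |` Gamma) chi) -> provable Gamma chi.
Proof.
move=> h; apply: (provable_bigOrE (provable_bigOr_Theta Gamma)) => Z _.
by have [X <-] := trace_surj Z; apply: h.
Qed.

(** Exhaustiveness needs no assumptions, so it can be applied inside the component [psi]; the
    resulting disjunction is then distributed out of the tensor. *)
Lemma provable_ten_diagram_cases (Gamma : set formula) phi psi chi :
  provable Gamma (Ten phi psi) ->
  (forall X, provable (Ten phi (And psi (diagram X)) |` Gamma) chi) ->
  provable Gamma chi.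
Proof.
move=> h hX.
have {}h : provable Gamma
    (Ten phi (bigOr [seq And psi (Theta Z) | Z <- enum {: {set {ffun I -> bool}}}])).
  apply: provable_tenS h _ _ => //.
  apply: (provable_bigOrE (provable_bigOr_Theta _)) => Z _.
  apply: (@provable_bigOrI _ _ _ Z); first by rewrite mem_enum.
  by apply: provable_andI; apply: provable_assume; [right | left].
apply: (provable_ten_bigOrE h) => Z _.
by have [X <-] := trace_surj Z; apply: hX.
Qed.

(** The enumeration of the joint trace and the concatenation of the two enumerations differ only in
    order and repetitions. *)
Lemma provable_diagramU X Y Gamma :
  provable Gamma (diagram (X `|` Y)) <-> provable Gamma (Ten (diagram X) (diagram Y)).
Proof.
have eqm : enum (trace (X `|` Y)) =i enum (trace X) ++ enum (trace Y).
  by move=> f; rewrite mem_cat !mem_enum traceU finset.in_setU.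
split=> [h|h].
  apply/provable_bigTen_cat; rewrite -map_cat.
  exact: (provable_bigTen_eq_mem provable_point_idem eqm) h.
apply: (provable_bigTen_eq_mem provable_point_idem (fsym eqm)).
by rewrite map_cat; apply/provable_bigTen_cat.
Qed.

Lemma provable_diagram_contr X Y Gamma : trace X <> trace Y ->
  provable Gamma (diagram X) -> provable Gamma (diagram Y) ->
  provable Gamma (And Bot NE).
Proof.
move=> nXY hX hY; apply: provable_rule (provable_andI hX hY) => D.
exact: d_Theta_contr.
Qed.

Lemma diagram_lit X i b Gamma : i \in I -> (forall s, X s -> s i = b) ->
  provable Gamma (diagram X) -> provable Gamma (lit i b).
Proof.
move=> iI Xb; apply: provable_bigTenE; first exact: classical_lit.
move=> f; rewrite mem_enum => /mem_trace[s Xs <-].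
have := provable_point_lit [` iI]%fset (provable_refl (point_formula (restr s))).
by rewrite ffunE /= Xb.
Qed.

(** The point of [s] is a component of the diagram and contradicts the literal, which is classical
    and hence may be used inside the tensor. *)
Lemma diagram_lit_contr X i b s Gamma : i \in I -> X s -> s i = ~~ b ->
  provable Gamma (diagram X) -> provable Gamma (lit i b) ->
  provable Gamma (And Bot NE).
Proof.
move=> iI Xs sib hX hi; apply: provable_cut hi _.
apply: (@provable_bigTen_contr _ (@point_formula I) (restr s) (enum (trace X))
  [set lit i b]).
- by move=> _ ->; apply: classical_lit.
- exact: subsetUl.
- by rewrite mem_enum; apply/mem_trace; exists s.
- by apply: provable_mono hX; apply: subsetUr.
have hs : provable (point_formula (restr s) |` [set lit i b]) (point_formula (restr s)).
  by apply: provable_assume; left.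
apply: provable_andI (provable_point_NE hs).
apply: (@provable_lit_contr _ i b); first by apply: provable_assume; right.
by have := provable_point_lit [` iI]%fset hs; rewrite ffunE /= sib.
Qed.

(** Idempotence brings a copy of the point of [s] to the front; this component proves [NE], hence so
    does the tensor. *)
Lemma diagram_NE X s Gamma : X s ->
  provable Gamma (diagram X) -> provable Gamma NE.
Proof.
move=> Xs h; have fX : restr s \in enum (trace X).
  by rewrite mem_enum; apply/mem_trace; exists s.
have := h; rewrite -(provable_bigTen_head provable_point_idem Gamma fX).
move=> /provable_bigTen_cons h1; apply: (@provable_tenNE _ (diagram X)).
by apply: provable_tenS h1 _ _ => //; apply: provable_point_NE.
Qed.

Lemma diagram_Bot Gamma :
  provable Gamma (diagram set0) <-> provable Gamma Bot.
Proof.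
suff E : diagram set0 = Bot by rewrite E.
rewrite /diagram; have -> : trace set0 = finset.set0.
  by apply/setP => f; rewrite finset.in_set0; apply/mem_trace => -[].
by rewrite /Theta enum_set0.
Qed.

(** * Diagrams decide every formula over their index set *)

Fixpoint formula_over phi : bool :=
  match phi with
  | Var i | NegVar i => i \in I
  | Bot | NE => true
  | And phi psi | Ten phi psi | Or phi psi => formula_over phi && formula_over psi
  end.

(** By induction on [phi]; in the tensor case the splitting of [X] splits its diagram. *)
Lemma provable_of_sat X phi Gamma : formula_over phi -> sat X phi ->
  provable Gamma (diagram X) -> provable Gamma phi.
Proof.
elim: phi X Gamma => [i|i|||phi IHphi psi IHpsi|phi IHphi psi IHpsi|phi IHphi psi IHpsi]
  X Gamma /=.
- exact: (@diagram_lit X i true).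
- exact: (@diagram_lit X i false).
- by move=> _ -> /diagram_Bot.
- by move=> _ /eqP/set0P[s Xs]; apply: diagram_NE Xs.
- move=> /andP[ophi opsi] [/IHphi hphi /IHpsi hpsi] h.
  by apply: provable_andI; [apply: hphi | apply: hpsi].
- move=> /andP[ophi opsi] [Y [Z [_ _ -> /IHphi hphi /IHpsi hpsi]]].
  move=> /provable_diagramU h; apply: provable_tenS h _ _.
    exact: hphi.
  exact: hpsi.
- move=> /andP[ophi opsi] [/IHphi hphi|/IHpsi hpsi] h.
    by apply: provable_rule (hphi _ ophi h) => D; apply: d_orIl.
  by apply: provable_rule (hpsi _ opsi h) => D; apply: d_orIr.
Qed.

Lemma contr_of_not_sat X phi Gamma : formula_over phi -> ~ sat X phi ->
  provable Gamma (diagram X) -> provable Gamma phi -> provable Gamma (And Bot NE).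
Proof.
elim: phi X Gamma => [i|i|||phi IHphi psi IHpsi|phi IHphi psi IHpsi|phi IHphi psi IHpsi]
  X Gamma /=.
- move=> iI /existsNP[s /not_implyP[Xs E]].
  by apply: (@diagram_lit_contr X i true s) => //; case: (s i) E.
- move=> iI /existsNP[s /not_implyP[Xs E]].
  by apply: (@diagram_lit_contr X i false s) => //; case: (s i) E.
- move=> _ /eqP/set0P[s Xs] h hB; apply: provable_andI hB _.
  exact: diagram_NE Xs h.
- move=> _ /contrapT -> /diagram_Bot hB hNE; exact: provable_andI.
- move=> /andP[ophi opsi] /not_andP[n|n] hX h.
    exact: IHphi n hX (provable_andEl h).
  exact: IHpsi n hX (provable_andEr h).
- move=> /andP[ophi opsi] nX hX h.
  (* The trace of each component is determined first: [Z] for [psi], then [Y] for [phi]. *)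
  apply: (provable_ten_diagram_cases h) => Z.
  have h1 : provable (Ten phi (And psi (diagram Z)) |` Gamma)
      (Ten (And psi (diagram Z)) phi).
    by apply: provable_tenC; apply: provable_assume; left.
  apply: (provable_ten_diagram_cases h1) => Y; set G := _ |` _.
  have {}h1 : provable G (Ten (And phi (diagram Y)) (And psi (diagram Z))).
    by apply: provable_tenC; apply: provable_assume; left.
  have {}hX : provable G (diagram X).
    by apply: provable_mono hX => ? ?; right; right.
  have [eqX|neX] := EM (trace X = trace (Y `|` Z)); last first.
    apply: (provable_diagram_contr neX hX); apply/provable_diagramU.
    by apply: provable_tenS h1 _ _; apply: provable_andEr.
  (* [Y] and [Z] need not be subteams of [X]. Since their joint trace is that of [X], they can be
     replaced by subteams with the same traces, hence the same diagrams, which together cover [X].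
     As [X] falsifies the tensor, one of these falsifies its component. *)
  pose part W := [set s | X s /\ restr s \in trace W].
  have trP W : W `<=` Y `|` Z -> trace (part W) = trace W.
    move=> sW; apply/setP => f; apply/mem_trace/idP; first by move=> [s [_ ?] <-].
    move=> fW; have : f \in trace X.
      by rewrite eqX; have /mem_trace[s /sW ? <-] := fW; apply/mem_trace; exists s.
    by move=> /mem_trace[s Xs sf]; exists s => //; split=> //; rewrite sf.
  have [nY|nZ] : ~ sat (part Y) phi \/ ~ sat (part Z) psi.
    apply/not_andP => -[sY sZ]; apply: nX; exists (part Y), (part Z); split=> //.
    + by move=> s [].
    + by move=> s [].
    rewrite eqEsubset; split=> [s Xs|s [[]|[]] //].
    have : restr s \in trace X by apply/mem_trace; exists s.
    by rewrite eqX traceU finset.in_setU => /orP[]; [left|right].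
  + apply: (@provable_ten_contr _ (And psi (diagram Z))).
    apply: provable_tenS (provable_tenC h1) _ _ => //.
    apply: IHphi nY _ (provable_andEl (provable_refl _)) => //.
    by rewrite /diagram trP; [apply: provable_andEr | apply: subsetUl].
  + apply: (@provable_ten_contr _ (And phi (diagram Y))).
    apply: provable_tenS h1 _ _ => //.
    apply: IHpsi nZ _ (provable_andEl (provable_refl _)) => //.
    by rewrite /diagram trP; [apply: provable_andEr | apply: subsetUr].
- move=> /andP[ophi opsi] /not_orP[nphi npsi] hX h.
  apply: (provable_orE h).
    apply: IHphi nphi _ (provable_assume _) => //; last by left.
    by apply: provable_mono hX; apply: subsetUr.
  apply: IHpsi npsi _ (provable_assume _) => //; last by left.
  by apply: provable_mono hX; apply: subsetUr.
Qed.

End IndexSet.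

(** * Change of index set, initial segments and limits of traces *)

(** Each point over [J] proves its restriction to [I]; distinct points may restrict to the same one,
    and idempotence removes the repetitions. *)
Lemma provable_diagram_restr (I J : {fset nat}) (X : team) Gamma :
  {subset I <= J} -> provable Gamma (diagram J X) -> provable Gamma (diagram I X).
Proof.
move=> sIJ h; pose r (f : {ffun J -> bool}) := restr I (extend f).
have rE s : r (restr J s) = restr I s.
  by apply/ffunP => i; rewrite !ffunE /extend (insubT (mem J) (sIJ _ (valP i))) ffunE.
have {}h : provable Gamma (bigTen [seq point_formula (r f) | f <- enum (trace J X)]).
  apply: provable_bigTen_map h => f _; apply: provable_pointI => [|i].
    exact: provable_point_NE.
  have := provable_point_lit [` sIJ _ (valP i)]%fset (provable_refl (point_formula f)).
  by rewrite ffunE /extend (insubT (mem J) (sIJ _ (valP i))).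
rewrite (map_comp (@point_formula I) r) in h.
apply: provable_bigTen_eq_mem h; first exact: provable_point_idem.
move=> g; rewrite mem_enum; apply/mapP/mem_trace.
  by move=> [f]; rewrite mem_enum => /mem_trace[s Xs <-] ->; exists s.
move=> [s Xs <-]; exists (restr J s); last by rewrite rE.
by rewrite mem_enum; apply/mem_trace; exists s.
Qed.

Definition initial (n : nat) : {fset nat} := [fset i in iota 0 n]%fset.

Lemma mem_initial n i : (i \in initial n) = (i < n)%N.
Proof. by rewrite /initial !inE mem_iota. Qed.

Lemma initial_subset m n : (m <= n)%N -> {subset initial m <= initial n}.
Proof. by move=> mn i; rewrite !mem_initial => /leq_trans; apply. Qed.

Lemma formula_over_initial phi : exists n, formula_over (initial n) phi.
Proof.
have mono (I J : {fset nat}) psi :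
    {subset I <= J} -> formula_over I psi -> formula_over J psi.
  move=> sIJ; elim: psi => /= [i|i|||p IHp q IHq|p IHp q IHq|p IHp q IHq];
    by [exact: sIJ | move=> /andP[/IHp-> /IHq->] | ].
have max p q : (exists n, formula_over (initial n) p) ->
    (exists n, formula_over (initial n) q) ->
    exists n, formula_over (initial n) p && formula_over (initial n) q.
  move=> [m hm] [n hn]; exists (maxn m n); apply/andP; split.
    by apply: mono hm; apply/initial_subset/leq_maxl.
  by apply: mono hn; apply/initial_subset/leq_maxr.
elim: phi => [i|i|||p IHp q IHq|p IHp q IHq|p IHp q IHq] /=; try exact: max.
- by exists i.+1; rewrite mem_initial.
- by exists i.+1; rewrite mem_initial.
- by exists 0%N.
- by exists 0%N.
Qed.

Lemma eq_restr_initial n s t :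
  restr (initial n) s = restr (initial n) t <-> (forall i, (i < n)%N -> s i = t i).
Proof.
split=> [/ffunP st i i_n|st].
  have iI : i \in initial n by rewrite mem_initial.
  by have := st [` iI]%fset; rewrite !ffunE.
apply/ffunP => i; rewrite !ffunE; apply: st.
by rewrite -mem_initial; apply: valP.
Qed.

(** The limit team consists of all valuations compatible with every trace. Compatibility lets any
    point of the [n]-th trace be extended level by level, and the extensions converge coordinatewise
    to a member of that team. *)
Lemma trace_limit (V : nat -> team) :
  (forall n, trace (initial n) (V n.+1) = trace (initial n) (V n)) ->
  exists X, forall n, trace (initial n) X = trace (initial n) (V n).
Proof.
move=> VS.
exists [set s | forall n, restr (initial n) s \in trace (initial n) (V n)] => n.
apply/setP => f; apply/mem_trace/idP => [[s /(_ n) + <-] //|/mem_trace[s0 V0 <-]].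
(* The membership [V k s] stands under the existential so that choice gives a function on all
   valuations. *)
have next k s : exists t, V k s ->
    V k.+1 t /\ restr (initial k) t = restr (initial k) s.
  have [Vs|nVs] := EM (V k s); last by exists s.
  have : restr (initial k) s \in trace (initial k) (V k.+1).
    by rewrite VS; apply/mem_trace; exists s.
  by move=> /mem_trace[t Vt ts]; exists t.
pose nxt k s := projT1 (cid (next k s)).
have nxtP k s : V k s ->
    V k.+1 (nxt k s) /\ restr (initial k) (nxt k s) = restr (initial k) s.
  exact: projT2 (cid (next k s)).
pose t := fix t k := if k is k'.+1 then nxt (n + k')%N (t k') else s0.
have Vt k : V (n + k)%N (t k).
  elim: k => [|k IHk]; first by rewrite addn0.
  by rewrite addnS; have [] := nxtP _ _ IHk.
have tS k i : (i < n + k)%N -> t k.+1 i = t k i.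
  by move=> ik; have [_ /eq_restr_initial] := nxtP _ _ (Vt k); apply.
have tD k j i : (i < n + k)%N -> t (k + j)%N i = t k i.
  move=> ik; elim: j => [|j IHj]; first by rewrite addn0.
  by rewrite addnS tS // (leq_trans ik) // leq_add2l leq_addr.
(* Coordinate [i] is stable from stage [k] on once [i < n + k]; stage [i.+1] meets this even for
   [n = 0], where stage [i] would not. *)
pose s i := t i.+1 i.
have sE k i : (i < n + k)%N -> s i = t k i.
  move=> ik; have [le|le] := leqP i.+1 k.
    by rewrite -(subnKC le) tD // addnS ltnS leq_addl.
  by rewrite /s -(subnKC (ltnW le)) tD.
exists s; last first.
  by apply/eq_restr_initial => i i_n; rewrite (sE 0%N) // addn0.
have big k : restr (initial (n + k)) s \in trace (initial (n + k)) (V (n + k)%N).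
  apply/mem_trace; exists (t k); first exact: Vt.
  by apply/eq_restr_initial => i ik; rewrite -sE.
(* Stages exist only from level [n] on. An arbitrary level [m] is reached from level [n + m] by [n]
   steps down. *)
have down k : restr (initial k.+1) s \in trace (initial k.+1) (V k.+1) ->
    restr (initial k) s \in trace (initial k) (V k).
  move=> /mem_trace[u Vu /eq_restr_initial us]; rewrite -VS; apply/mem_trace.
  by exists u => //; apply/eq_restr_initial => i ik; apply: us; apply: leqW.
move=> /= m; have: restr (initial (n + m)) s \in trace (initial (n + m)) (V (n + m)%N).
  exact: big.
by elim: (n) => [//|k IHk]; rewrite addSn => /down.
Qed.

(** * Strong completeness by construction of a countermodel *)

Theorem theorem5p7 (Gamma : set formula) (phi : formula) :
  entails Gamma phi -> provable Gamma phi.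
Proof.
move=> ent; apply: contrapT => nphi.
pose good n X := ~ provable (diagram (initial n) X |` Gamma) phi.
have good0 : exists X, good 0%N X.
  by apply/existsNP => h; apply: nphi; apply: provable_diagram_cases h.
have goodS n X : exists Y, good n X ->
    good n.+1 Y /\ trace (initial n) Y = trace (initial n) X.
  have [gX|ngX] := EM (good n X); last by exists X.
  suff [Y gY] : exists Y, ~ provable
      (diagram (initial n.+1) Y |` (diagram (initial n) X |` Gamma)) phi.
    exists Y => _.
    have hY : provable (diagram (initial n.+1) Y |` (diagram (initial n) X |` Gamma))
        (diagram (initial n) Y).
      apply: provable_diagram_restr (initial_subset (leqnSn n)) _.
      by apply: provable_assume; left.
    have eqXY : trace (initial n) Y = trace (initial n) X.
      apply: contrapT => neq; apply: gY; apply: provable_contr.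
      apply: (provable_diagram_contr neq hY).
      by apply: provable_assume; right; left.
    split=> // h; apply: gY; apply: provable_mono h.
    by move=> ? [->|?]; [left | right; right].
  by apply/existsNP => h; apply: gX; apply: provable_diagram_cases h.
pose next n X := projT1 (cid (goodS n X)).
have nextP n X : good n X ->
    good n.+1 (next n X) /\ trace (initial n) (next n X) = trace (initial n) X.
  exact: projT2 (cid (goodS n X)).
have [V0 gV0] := good0.
pose V := fix V n := if n is n'.+1 then next n' (V n') else V0.
have gV n : good n (V n) by elim: n => [//|n IHn]; have [] := nextP _ _ IHn.
have [X XV] : exists X, forall n, trace (initial n) X = trace (initial n) (V n).
  by apply: trace_limit => n; have [_] := nextP _ _ (gV n).
(* The diagrams of [X] and [V n] over [initial n] are the same formula. *)
have gX n : good n X by rewrite /good /diagram XV; apply: gV.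
have [n over_phi] := formula_over_initial phi.
apply: (gX n); apply: provable_of_sat over_phi _ (provable_assume _); last by left.
(* A formula of [Gamma] false in [X] would contradict a diagram of [X], which would then prove [phi]
   together with [Gamma]. *)
apply: ent => psi Gpsi; apply: contrapT => npsi.
have [m over_psi] := formula_over_initial psi.
apply: (gX m); apply: provable_contr.
by apply: contr_of_not_sat over_psi npsi _ _; apply: provable_assume; [left | right].
Qed.
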